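(* Let $\Gamma$ be an arbitrary finitely generated Fuchsian group and let $g\in\Gamma$. Then the following are equivalent: (1) $g$ is reciprocal; (2) $g$ is either an involution or conjugate to a hyperbolic element $h$ such that the hyperbolic axis of $h$ passes through some (at least one) of the even-order vertices of the fundamental domain of $\Gamma$.
   Context: A Fuchsian group is a discrete subgroup of $\mathrm{PSL}(2,\mathbb R)$ acting on the hyperbolic plane. A non-trivial element $g\in\Gamma$ is called reciprocal (equivalently, reversible) if there is $k\in\Gamma$ with $kgk^{-1}=g^{-1}$. The fundamental domain of $\Gamma$ is a fundamental polygon for which every fixed point of an elliptic element in the (closed) domain is counted as a vertex (including fixed points of order-2 elements lying on a side). An even-order vertex is a vertex whose stabilizer in $\Gamma$ is a finite cyclic group of even order. *)

(* Defs.v *)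
From HB Require Import structures.
From mathcomp Require Import all_boot all_order all_algebra.
From mathcomp Require Import complex ring.
From mathcomp Require Import all_classical all_reals topology.
Import Order.TTheory GRing.Theory Num.Theory numFieldTopology.Exports.

Set Implicit Arguments.
Unset Strict Implicit.
Unset Printing Implicit Defensive.

Local Open Scope classical_set_scope.
Local Open Scope ring_scope.
Local Open Scope complex_scope.
Local Open Scope quotient_scope.

Local Notation Re := complex.Re.
Local Notation Im := complex.Im.

Record SL2 (R : realType) := MkSL2 {
  SL2_mx :> 'M[R]_2;
  SL2_det : \det SL2_mx == 1
}.
HB.instance Definition _ (R : realType) := [isSub for @SL2_mx R].
HB.instance Definition _ (R : realType) := [Choice of SL2 R by <:].
HB.instance Definition _ (R : realType) := Topological.copy (SL2 R)
  (initial_topology (@SL2_mx R : SL2 R -> 'M[R]_2)).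

Section PSL2.
Variable R : realType.
Implicit Types (A B : SL2 R).

Lemma detSL2 A : \det A = 1 :> R. Proof. exact/eqP/SL2_det. Qed.

Lemma unitSL2 A : (A : 'M[R]_2) \in unitmx.
Proof. by rewrite unitmxE detSL2 unitr1. Qed.

Lemma SL2_one_subproof : \det (1%:M : 'M[R]_2) == 1.
Proof. by rewrite det1. Qed.
Definition SL2_one : SL2 R := MkSL2 SL2_one_subproof.

Lemma SL2_mul_subproof A B : \det (A *m B : 'M[R]_2) == 1.
Proof. by rewrite det_mulmx !detSL2 mulr1. Qed.
Definition SL2_mul A B : SL2 R := MkSL2 (SL2_mul_subproof A B).

Lemma SL2_inv_subproof A : \det (invmx A : 'M[R]_2) == 1.
Proof. by rewrite det_inv detSL2 invr1. Qed.
Definition SL2_inv A : SL2 R := MkSL2 (SL2_inv_subproof A).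

Definition SL2_pm A B := (val A == val B) || (val A == - val B).

Lemma SL2_pm_equiv : equiv_class_of SL2_pm.
Proof.
have pm_sym : symmetric SL2_pm.
  by move=> A B; rewrite /SL2_pm eq_sym [val A == - _]eq_sym eqr_oppLR.
split=> [A|//|B A C]; first by rewrite /SL2_pm eqxx.
move=> /orP[] /eqP AB /orP[] /eqP BC; rewrite /SL2_pm AB BC ?opprK ?eqxx ?orbT //.
Qed.
Canonical SL2_pm_equivRel := EquivRelPack SL2_pm_equiv.

Definition PSL2 := quotient_topology {eq_quot SL2_pm}.
HB.instance Definition _ := Quotient.on PSL2.
HB.instance Definition _ := Choice.on PSL2.
HB.instance Definition _ := Topological.on PSL2.

Lemma pi_PSL2E A B : \pi_PSL2 A = \pi_PSL2 B <-> SL2_pm A B.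
Proof. by split=> [/eqmodP|/eqmodP]. Qed.

Lemma PSL2W (P : PSL2 -> Prop) : (forall A, P (\pi_PSL2 A)) -> forall g, P g.
Proof. by move=> + g; rewrite -[g]reprK; apply. Qed.

Lemma repr_PSL2 A : SL2_pm (repr (\pi_PSL2 A)) A.
Proof. by apply/pi_PSL2E; rewrite reprK. Qed.

Definition PSL2_one : PSL2 := \pi_PSL2 SL2_one.
Definition PSL2_mul (g h : PSL2) : PSL2 := \pi_PSL2 (SL2_mul (repr g) (repr h)).
Definition PSL2_inv (g : PSL2) : PSL2 := \pi_PSL2 (SL2_inv (repr g)).

Lemma pi_SL2_mul A B :
  PSL2_mul (\pi_PSL2 A) (\pi_PSL2 B) = \pi_PSL2 (SL2_mul A B).
Proof.
apply/pi_PSL2E; move: (repr_PSL2 A) (repr_PSL2 B); rewrite /SL2_pm /=.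
move=> /orP[] /eqP -> /orP[] /eqP ->;
  by rewrite ?mulmxN ?mulNmx ?opprK eqxx ?orbT.
Qed.

Lemma invmxN_SL2 A : invmx (- (A : 'M[R]_2)) = - invmx A.
Proof.
have uN : - (A : 'M[R]_2) \in unitmx by rewrite -scaleN1r unitmxZ ?unitSL2 ?unitrN1.
by rewrite -[RHS](mulmxK uN) mulNmx mulmxN opprK mulVmx ?unitSL2 // mul1mx.
Qed.

Lemma pi_SL2_inv A : PSL2_inv (\pi_PSL2 A) = \pi_PSL2 (SL2_inv A).
Proof.
apply/pi_PSL2E; move: (repr_PSL2 A); rewrite /SL2_pm /=.
by move=> /orP[] /eqP ->; rewrite ?invmxN_SL2 eqxx ?orbT.
Qed.

Lemma PSL2_mulA : associative PSL2_mul.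
Proof.
apply: PSL2W => A; apply: PSL2W => B; apply: PSL2W => C; rewrite !pi_SL2_mul.
by congr (\pi_PSL2 _); apply/val_inj; rewrite /= mulmxA.
Qed.
Lemma PSL2_mul1 : left_id PSL2_one PSL2_mul.
Proof.
by apply: PSL2W => A; rewrite pi_SL2_mul; congr (\pi_PSL2 _); apply/val_inj; rewrite /= mul1mx.
Qed.
Lemma PSL2_mulr1 : right_id PSL2_one PSL2_mul.
Proof.
by apply: PSL2W => A; rewrite pi_SL2_mul; congr (\pi_PSL2 _); apply/val_inj; rewrite /= mulmx1.
Qed.
Lemma PSL2_mulV : left_inverse PSL2_one PSL2_inv PSL2_mul.
Proof.
apply: PSL2W => A; rewrite pi_SL2_inv pi_SL2_mul; congr (\pi_PSL2 _); apply/val_inj.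
by rewrite /= mulVmx ?unitSL2.
Qed.
Lemma PSL2_mulrV : right_inverse PSL2_one PSL2_inv PSL2_mul.
Proof.
apply: PSL2W => A; rewrite pi_SL2_inv pi_SL2_mul; congr (\pi_PSL2 _); apply/val_inj.
by rewrite /= mulmxV ?unitSL2.
Qed.
HB.instance Definition _ := isGroup.Build PSL2
  PSL2_mulA PSL2_mul1 PSL2_mulr1 PSL2_mulV PSL2_mulrV.

End PSL2.

Record UHP (R : realType) := MkUHP {
  UHP_val :> R[i];
  UHP_gt0 : 0 < Im UHP_val
}.
HB.instance Definition _ (R : realType) := [isSub for @UHP_val R].
HB.instance Definition _ (R : realType) := [Choice of UHP R by <:].
HB.instance Definition _ (R : realType) := Topological.copy (UHP R)
  (initial_topology (fun z : UHP R => (Re z, Im z) : R * R)).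

Section HyperbolicPlane.
Variable R : realType.
Implicit Types (A : SL2 R) (g : PSL2 R) (z : UHP R) (D : set (UHP R)).

Definition mobius A (z : R[i]) : R[i] :=
  ((A 0 0)%:C * z + (A 0 1)%:C) / ((A 1 0)%:C * z + (A 1 1)%:C).

Lemma detSL2E A : A 0 0 * A 1 1 - A 0 1 * A 1 0 = 1.
Proof.
rewrite -(detSL2 A) (expand_det_row _ 0) !big_ord_recl big_ord0 addr0.
rewrite /cofactor !det_mx11 !mxE /= expr0 expr1 mul1r mulN1r mulrN.
congr (_ * _ - A _ _ * A _ _); try congr (A _ _); exact/val_inj.
Qed.

Lemma mobius_den_neq0 A z : (A 1 0)%:C * (z : R[i]) + (A 1 1)%:C != 0.
Proof.
case: z => -[x y] /= y0; apply/eqP=> /eqP; rewrite eq_complex /=.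
rewrite !mul0r subr0 !addr0 mulf_eq0 (gt_eqF y0) orbF => /andP[/eqP + /eqP c0].
rewrite c0 mul0r add0r => d0; have := detSL2E A.
by rewrite c0 d0 !mulr0 subr0 => /esym/eqP; rewrite oner_eq0.
Qed.

Lemma mobius_gt0 A z : 0 < Im (mobius A z).
Proof.
have := mobius_den_neq0 A z; have := detSL2E A; rewrite /mobius.
case: z => -[x y] /= y0; move: (A 0 0) (A 0 1) (A 1 0) (A 1 1) => a b c d dt.
rewrite eq_complex /= !mul0r !subr0 !addr0 => cd0.
have N0 : 0 < (c * x + d) ^+ 2 + (c * y) ^+ 2.
  rewrite lt_def addr_ge0 ?sqr_ge0 // andbT paddr_eq0 ?sqr_ge0 //.
  by rewrite !sqrf_eq0.
have -> : (a * x + b) * - (c * y / ((c * x + d) ^+ 2 + (c * y) ^+ 2)) +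
  a * y * ((c * x + d) / ((c * x + d) ^+ 2 + (c * y) ^+ 2)) =
  (a * d - b * c) * y / ((c * x + d) ^+ 2 + (c * y) ^+ 2).
  by field; rewrite (gt_eqF N0).
by rewrite dt mul1r divr_gt0.
Qed.

Definition act g z : UHP R := MkUHP (mobius_gt0 (repr g) z).

Lemma act_pi A z : act (\pi_(PSL2 R) A) z = mobius A z :> R[i].
Proof.
rewrite /= /mobius; have := repr_PSL2 A; rewrite /SL2_pm /=.
move=> /orP[] /eqP -> //; rewrite !mxE !raddfN /= !mulNr -!opprD invrN mulrNN //.
Qed.

Lemma act1 z : act 1%g z = z.
Proof.
apply/val_inj; rewrite [LHS]act_pi /mobius /= !mxE /=.
by rewrite mul1r mul0r add0r addr0 divr1.
Qed.

Lemma actM g h z : act (g * h)%g z = act g (act h z).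
Proof.
apply/val_inj; rewrite [LHS]act_pi /=.
have := mobius_den_neq0 (repr g) (act h z); have := mobius_den_neq0 (repr h) z.
have := mobius_den_neq0 (SL2_mul (repr g) (repr h)) z.
rewrite /act /= /mobius /= !mxE !big_ord_recl !big_ord0 !addr0.
rewrite !(rmorphD, rmorphM) /=.
have -> : lift 0 0 = 1 :> 'I_2 by exact/val_inj.
rewrite -[ord0]/(0 : 'I_2) => gh0 h0 _; field; apply/andP; split=> //.
by move: gh0; congr (_ != 0); ring.
Qed.

(* The ideal boundary is R together with the point at infinity [None]. *)
Definition bdry := option R.

Definition bdry_mobius A (u : bdry) : bdry :=
  if u is Some x then
    if A 1 0 * x + A 1 1 == 0 then None
    else Some ((A 0 0 * x + A 0 1) / (A 1 0 * x + A 1 1))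
  else if A 1 0 == 0 then None else Some (A 0 0 / A 1 0).

Definition bdry_act g (u : bdry) : bdry := bdry_mobius (repr g) u.

Lemma bdry_act_pi A u : bdry_act (\pi_(PSL2 R) A) u = bdry_mobius A u.
Proof.
rewrite /bdry_act /bdry_mobius; have := repr_PSL2 A; rewrite /SL2_pm /=.
move=> /orP[] /eqP -> //; case: u => [x|]; rewrite !mxE.
  by rewrite !mulNr -!opprD oppr_eq0 invrN mulrNN.
by rewrite oppr_eq0 invrN mulrNN.
Qed.

(* The trace is only defined up to sign on PSL(2, R). *)
Definition abs_tr g : R := `|\tr (repr g : 'M[R]_2)|.

Lemma abs_tr_pi A : abs_tr (\pi_(PSL2 R) A) = `|\tr (A : 'M[R]_2)|.
Proof.
rewrite /abs_tr; have := repr_PSL2 A; rewrite /SL2_pm /=.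
by move=> /orP[] /eqP -> //; rewrite raddfN normrN.
Qed.

Definition elliptic g := abs_tr g < 2.
Definition hyperbolic g := 2 < abs_tr g.

(* The geodesic with ideal endpoints u and v: a vertical half-line, or the
   half-circle with diameter [u, v]; empty when u = v. *)
Definition geodesic (u v : bdry) : set (UHP R) := [set z |
  match u, v with
  | Some x, Some y => (Re z - x) * (Re z - y) + Im z ^+ 2 = 0
  | Some x, None | None, Some x => Re z = x
  | None, None => False
  end].

Definition geodesic_line (L : set (UHP R)) :=
  exists u v, u != v /\ L = geodesic u v.

Definition axis g : set (UHP R) := [set z | exists u v,
  [/\ u != v, bdry_act g u = u, bdry_act g v = v & geodesic u v z]].

Definition frontier D : set (UHP R) := closure D `\` D°.

(* Segments, rays and full lines. *)
Definition geodesic_arc (S : set (UHP R)) :=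
  [/\ closed S, connected S, exists z w, [/\ S z, S w & z <> w] &
      exists2 L, geodesic_line L & S `<=` L].

Definition locally_finite (F : set (set (UHP R))) := forall z,
  exists2 U, nbhs z U & finite_set [set S | F S /\ S `&` U !=set0].

(* A closed polygonal region, not necessarily convex or compact. *)
Definition polygon D :=
  [/\ D = closure D°, D° !=set0, connected D° &
      exists F : set (set (UHP R)),
        [/\ F `<=` geodesic_arc, locally_finite F &
            frontier D = \bigcup_(S in F) S]].

(* A boundary point near which the boundary is not a geodesic. *)
Definition corner D z := frontier D z /\
  ~ exists L U, [/\ geodesic_line L, nbhs z U & frontier D `&` U = L `&` U].

End HyperbolicPlane.

Section Fuchsian.
Variable R : realType.
Implicit Types (G : set (PSL2 R)) (D : set (UHP R)) (g h : PSL2 R).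

Definition discrete G := G `<=` isolated G.

Definition fuchsian G := group_closed [in G] /\ discrete G.

Definition finitely_generated G := exists2 S : set (PSL2 R),
  finite_set S & G = smallest (fun H => group_closed [in H]) S.

Definition reciprocal G g := g <> 1%g /\
  exists2 k, k \in G & (k * g * k^-1 = g^-1)%g.

Definition involution g := g <> 1%g /\ (g ^+ 2 = 1)%g.

Definition conjugate_in G g h := exists2 k, k \in G & (h = k * g * k^-1)%g.

Definition stabilizer G (z : UHP R) := [set g | g \in G /\ act g z = z].

Definition finite_cyclic_of_order (n : nat) (H : set (PSL2 R)) :=
  (H #= `I_n)%card /\ exists g, H = [set (g ^+ k)%g | k in [set: nat]].

(* [D] is closed by [polygon]; neither convexity nor local finiteness of the
   tessellation is required. *)
Definition fundamental_polygon G D :=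
  [/\ polygon D,
      \bigcup_(g in G) (act g @` D) = setT &
      forall g, g \in G -> g <> 1%g -> D° `&` (act g @` D°) = set0].

(* Elliptic fixed points count as vertices even when they are not corners. *)
Definition vertex G D z := corner D z \/
  (D z /\ exists g, [/\ g \in G, elliptic g & act g z = z]).

Definition even_order_vertex G D z := vertex G D z /\
  exists2 n, ~~ odd n & finite_cyclic_of_order n (stabilizer G z).

End Fuchsian.

(* Main.v *)
(** If [k] reverses a [g] with [g ^ 2 <> 1], lift both to matrices [K] and [A] in
    SL(2, R). Then [K A = - A^-1 K] would force [tr A = 0], i.e. [g ^ 2 = 1], so
    [K A = A^-1 K], and this forces [tr K = tr (K A) = 0]. Hence [k] is a
    half-turn about some point [z]. The entries of [A] being [a], [b], [c], [d], the
    identity [tr (K A) = 0] reads [c |z| ^ 2 + (d - a) Re z - b = 0]: the quadratic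
    equation for the ideal fixed points of [g] has positive discriminant, so
    [g] is hyperbolic, and [z] lies on its axis. An element of [G] moves [z] into the
    domain [D]. The computation can be run backwards for any half-turn about a
    point of the axis.

    The stabilizer of a point in a discrete group is finite cyclic because
    its rotation angles form a discrete subgroup of R containing [pi], and
    such a finite cyclic group has even order exactly when it contains an
    involution. *)

Require Import Defs.
From mathcomp Require Import all_boot all_order all_algebra.
From mathcomp Require Import complex ring lra zify.
From mathcomp Require Import all_classical all_reals topology.
From mathcomp Require Import normedtype trigo.

Set Implicit Arguments.
Unset Strict Implicit.
Unset Printing Implicit Defensive.

Import Order.TTheory GRing.Theory Num.Theory numFieldTopology.Exports numFieldNormedType.Exports.

Local Open Scope classical_set_scope.
Local Open Scope ring_scope.
Local Open Scope quotient_scope.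

(** * Orders of cyclic groups and discrete subgroups of the real line *)

Lemma card_powers_order (gT : groupType) (a : gT) (n : nat) :
  (0 < n)%N -> (a ^+ n = 1)%g ->
  (forall j, (0 < j < n)%N -> (a ^+ j != 1)%g) ->
  ([set (a ^+ k)%g | k in [set: nat]] #= `I_n)%card.
Proof.
move=> n0 an amin; rewrite card_eq_sym.
have inj_lt i j : (i < j)%N -> (j < n)%N -> (a ^+ i)%g = (a ^+ j)%g -> False.
  move=> ij jn; rewrite -{1}(subnK (ltnW ij)) expgnDr => /esym.
  rewrite -[X in _ = X -> _]mul1g => /mulIg/eqP.
  by apply/negP/amin; rewrite subn_gt0 ij (leq_ltn_trans (leq_subr _ _)).
have -> : [set (a ^+ k)%g | k in [set: nat]] = [set (a ^+ k)%g | k in `I_n];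
  last first.
  rewrite card_eq_sym; apply: inj_card_eq => i j; rewrite !inE /= => ilt jlt eq_ij.
  case: (ltngtP i j) => // lt_ij; exfalso.
    exact: (inj_lt _ _ lt_ij jlt eq_ij).
  exact: (inj_lt _ _ lt_ij ilt (esym eq_ij)).
apply/seteqP; split=> _ [k _ <-]; last by exists k.
exists (k %% n)%N; first by rewrite /= ltn_mod.
by rewrite {2}(divn_eq k n) expgnDr mulnC expgnA an expg1n mul1g.
Qed.

(** Counting the powers identifies [n] with the order [m] of [a], so half of [m] is the required
    exponent. *)
Lemma even_cyclic_involution (gT : groupType) (a : gT) (n : nat) :
  ~~ odd n -> ([set (a ^+ k)%g | k in [set: nat]] #= `I_n)%card ->
  exists j, (a ^+ j != 1)%g /\ (a ^+ j ^+ 2 = 1)%g.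
Proof.
move=> n_even card_a.
have fin_a : finite_set [set (a ^+ k)%g | k in [set: nat]].
  by exists n.
have [m0 /andP[m0_gt0 am0]] : exists m, (0 < m)%N && (a ^+ m == 1)%g.
  (* If no positive power of [a] were trivial, the powers would be pairwise distinct, and a finite
     set would pull back injectively to all of [nat]. *)
  apply: contrapT => no_m; apply: infinite_nat.
  rewrite -(@preimage_range _ _ (fun k => (a ^+ k)%g)).
  apply: finite_preimage fin_a => i j _ _ eq_ij.
  wlog lt_ij : i j eq_ij / (i < j)%N.
    move=> hw; case: (ltngtP i j) => // lt_ij; first exact: hw.
    by symmetry; apply: hw.
  exfalso; apply: no_m; exists (j - i)%N; rewrite subn_gt0 lt_ij /=.
  apply/eqP/(mulIg (a ^+ i)%g).
  by rewrite -expgnDr (subnK (ltnW lt_ij)) mul1g.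
have ex_m : exists m, (0 < m)%N && (a ^+ m == 1)%g.
  by exists m0; rewrite m0_gt0.
case: (ex_minnP ex_m) => m /andP[m_gt0 /eqP am] m_min.
have lt_m j : (0 < j < m)%N -> (a ^+ j != 1)%g.
  move=> /andP[j0 jm]; apply/eqP=> aj; have := m_min j.
  by rewrite j0 aj eqxx leqNgt jm => /(_ isT).
have mn : m = n.
  apply/card_eq_II; apply: card_eq_trans card_a.
  by rewrite card_eq_sym; exact: card_powers_order.
exists m./2; split.
  by apply: lt_m; rewrite -{3}(odd_double_half m); move: n_even m_gt0; rewrite -mn; lia.
by rewrite -expgnA muln2 even_halfK ?mn // -mn.
Qed.

(** The gap [e] makes the infimum of the positive elements a minimum, which generates by Euclidean
    division. *)
Lemma discrete_subgroup_line (R : realType) (P : R -> Prop) (e a : R) :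
  (forall x y, P x -> P y -> P (x - y)) -> 0 < e ->
  (forall x, 0 < x < e -> ~ P x) -> 0 < a -> P a ->
  exists t, [/\ 0 < t, P t & forall x, 0 <= x -> P x -> exists k : nat, x = k%:R * t].
Proof.
move=> PB e0 Pe a0 Pa; pose S := [set x | 0 < x /\ P x].
have S_e x : S x -> e <= x.
  by move=> [x0 Px]; rewrite leNgt; apply/negP=> xe; apply: (Pe x) => //; rewrite x0.
have has_infS : has_inf S by split; [exists a | exists e].
have lb x : S x -> inf S <= x by move=> Sx; apply: ge_inf => //; exists e.
(* [t] is within [e] of the infimum, so a smaller positive element [x] would put [t - x] into the
   gap. *)
have [t [t0 Pt] te] := inf_adherent e0 has_infS.
have tmin x : S x -> t <= x.
  move=> Sx; rewrite leNgt; apply/negP=> xt; have := lb _ Sx; case: Sx => x0 Px infx.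
  by apply: (Pe (t - x)); [apply/andP; split; lra|exact: PB].
exists t; split => // x x0 Px.
have Pmul k : P (x - k%:R * t).
  elim: k => [|k IH]; first by rewrite mul0r subr0.
  by rewrite -[in _ * _]natr1 mulrDl mul1r opprD addrA; exact: PB.
(* The remainder of [x] modulo [t] satisfies [P] and is below [t], hence vanishes by minimality. *)
exists (Num.truncn (x / t)).
have /andP[lo hi] := truncn_itv (divr_ge0 x0 (ltW t0)).
move: lo hi (Pmul (Num.truncn (x / t))); rewrite ler_pdivlMr // ltr_pdivrMr //.
set k := Num.truncn _ => lo hi Pr.
apply/eqP; rewrite -subr_eq0 eq_le subr_ge0 lo andbT leNgt; apply/negP=> r0.
have := tmin _ (conj r0 Pr); move: hi; rewrite -natr1; nra.
Qed.

(** * Matrix entries and the passage from SL(2, R) to PSL(2, R) *)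

Section MatrixEntries.
Variable R : realType.
Implicit Types (A B K : SL2 R) (z : UHP R).

Lemma ord2_forall (P : 'I_2 -> Prop) : P 0 -> P 1 -> forall i, P i.
Proof.
move=> P0 P1 i; case: (i =P 0) => [->//|/eqP i0].
suff -> : i = 1 by [].
by apply/val_inj => /=; move: i0; rewrite -val_eqE /=; case: i => -[|[|]].
Qed.

Lemma mx2P (M N : 'M[R]_2) :
  [/\ M 0 0 = N 0 0, M 0 1 = N 0 1, M 1 0 = N 1 0 & M 1 1 = N 1 1] <-> M = N.
Proof.
split=> [[e00 e01 e10 e11]|-> //]; apply/matrixP.
by apply: ord2_forall; apply: ord2_forall.
Qed.

Lemma pi_eqP A B : \pi_(PSL2 R) A = \pi_(PSL2 R) B <->
  [/\ A 0 0 = B 0 0, A 0 1 = B 0 1, A 1 0 = B 1 0 & A 1 1 = B 1 1] \/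
  [/\ A 0 0 = - B 0 0, A 0 1 = - B 0 1, A 1 0 = - B 1 0 & A 1 1 = - B 1 1].
Proof.
rewrite pi_PSL2E /SL2_pm; split.
  by move=> /orP[]/eqP/mx2P; [left|rewrite !mxE; right].
by case=> [/mx2P/eqP AB|AB]; apply/orP; [left|right; apply/eqP/mx2P; rewrite !mxE].
Qed.

Lemma mulmx2E (M N : 'M[R]_2) i j :
  (M *m N) i j = M i 0 * N 0 j + M i 1 * N 1 j.
Proof.
rewrite mxE !big_ord_recl big_ord0 addr0.
by congr (_ * _ + _ * _); congr (_ _ _); exact/val_inj.
Qed.

Lemma SL2_mulE A B (i j : 'I_2) :
  SL2_mul A B i j = A i 0 * B 0 j + A i 1 * B 1 j.
Proof. exact: mulmx2E. Qed.

Definition mx2 (a b c d : R) : 'M[R]_2 :=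
  \matrix_(i, j) if i == 0 then if j == 0 then a else b
                 else if j == 0 then c else d.

Lemma mx2E a b c d :
  (mx2 a b c d 0 0 = a) * (mx2 a b c d 0 1 = b) *
  (mx2 a b c d 1 0 = c) * (mx2 a b c d 1 1 = d).
Proof. by rewrite !mxE. Qed.

Lemma det_mx2 (M : 'M[R]_2) : \det M = M 0 0 * M 1 1 - M 0 1 * M 1 0.
Proof.
rewrite (expand_det_row _ 0) !big_ord_recl big_ord0 addr0.
rewrite /cofactor !det_mx11 !mxE /= expr0 expr1 mul1r mulN1r mulrN.
by congr (_ * _ - M _ _ * M _ _); try congr (M _ _); exact/val_inj.
Qed.

Lemma SL2_invE A : SL2_inv A = mx2 (A 1 1) (- A 0 1) (- A 1 0) (A 0 0) :> 'M[R]_2.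
Proof.
have dA := detSL2E A.
rewrite /= -[RHS](mulKmx (unitSL2 A)).
suff -> : A *m mx2 (A 1 1) (- A 0 1) (- A 1 0) (A 0 0) = 1%:M by rewrite mulmx1.
by apply/mx2P; rewrite !mulmx2E !mx2E !mxE /=; split; lra.
Qed.

Lemma mxtrace2 A : \tr A = A 0 0 + A 1 1.
Proof.
rewrite /mxtrace !big_ord_recl big_ord0 addr0.
by congr (_ + A _ _); exact/val_inj.
Qed.

Lemma pi_eq1P A : \pi_(PSL2 R) A = 1%g <-> [/\ A 0 1 = 0, A 1 0 = 0 & A 0 0 = A 1 1].
Proof.
rewrite (_ : 1%g = \pi_(PSL2 R) (SL2_one R)) // pi_eqP /= !mxE /= mulr1n mulr0n oppr0.
split; first by move=> [][-> -> -> ->].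
move=> [b0 c0 ad]; have := detSL2E A; rewrite b0 c0 ad mul0r subr0 => /eqP.
rewrite -expr2 sqrf_eq1 => /orP[]/eqP->; [left|right]; split=> //.
Qed.

Lemma pi_mulE A B :
  (\pi_(PSL2 R) A * \pi_(PSL2 R) B)%g = \pi_(PSL2 R) (SL2_mul A B).
Proof. exact: pi_SL2_mul. Qed.

Lemma pi_invE A : ((\pi_(PSL2 R) A)^-1)%g = \pi_(PSL2 R) (SL2_inv A).
Proof. exact: pi_SL2_inv. Qed.

(** The off-diagonal entries and the diagonal difference of the square are those of [A] multiplied
    by the trace. *)
Lemma sqr_eq1_trace A : (\pi_(PSL2 R) A ^+ 2 = 1)%g <-> 
  \pi_(PSL2 R) A = 1%g \/ A 0 0 + A 1 1 = 0.
Proof.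
rewrite expg2 pi_mulE !pi_eq1P !SL2_mulE; split=> [[e1 e2 e3]|[[b0 c0 ad]|ad]].
- have [t0|t0] := eqVneq (A 0 0 + A 1 1) 0; [by right|left].
  have b0 : A 0 1 = 0 by apply: (mulIf t0); lra.
  have c0 : A 1 0 = 0 by apply: (mulIf t0); lra.
  by split=> //; apply: (mulIf t0); lra.
- by rewrite b0 c0 ad; split; lra.
- have -> : A 1 1 = - A 0 0 by lra.
  by split; lra.
Qed.

(** * Fixed points in the plane and on its boundary, and axes *)

(** These are the imaginary part, divided by [Im z], and the real part of
    [a z + b = z (c z + d)]. *)
Lemma act_fixP A z : act (\pi_(PSL2 R) A) z = z <->
  A 1 1 - A 0 0 = - (2 * A 1 0 * complex.Re z) /\
  A 0 1 = - (A 1 0 * (complex.Re z ^+ 2 + complex.Im z ^+ 2)).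
Proof.
have den0 := mobius_den_neq0 A z.
have fixE : act (\pi_(PSL2 R) A) z = z <->
    (A 0 0)%:C%C * (z : R[i]) + (A 0 1)%:C%C =
    (z : R[i]) * ((A 1 0)%:C%C * (z : R[i]) + (A 1 1)%:C%C).
  split=> [/(congr1 val)|num].
    rewrite [X in X = _]act_pi /mobius => e.
    by rewrite -[LHS](divfK den0) e.
  by apply/val_inj; rewrite [LHS]act_pi /mobius num mulfK.
rewrite fixE; case: z {den0 fixE} => -[x y] /= y0.
split=> [/eqP|[da b]].
  rewrite eq_complex /= => /andP[/eqP re /eqP im].
  have yn0 : y != 0 by rewrite gt_eqF.
  have da : A 1 1 - A 0 0 = - (2 * A 1 0 * x) by apply: (mulIf yn0); lra.
  by split=> //; nra.
by apply/eqP; rewrite eq_complex /=; apply/andP; split; apply/eqP; nra.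
Qed.

Lemma bdry_fix_SomeP A (u : R) :
  bdry_act (\pi_(PSL2 R) A) (Some u) = Some u <->
  A 1 0 * u ^+ 2 + (A 1 1 - A 0 0) * u - A 0 1 = 0.
Proof.
have dA := detSL2E A; rewrite bdry_act_pi /=; case: eqVneq => [den0|den0].
  (* With a zero denominator, the quadratic equation would kill the numerator too, against
     determinant 1. *)
  split=> // e; have num0 : A 0 0 * u + A 0 1 = 0.
    have -> : A 0 0 * u + A 0 1 =
      u * (A 1 0 * u + A 1 1) - (A 1 0 * u ^+ 2 + (A 1 1 - A 0 0) * u - A 0 1) by ring.
    by rewrite den0 e mulr0 subr0.
  have : A 0 0 * (A 1 0 * u + A 1 1) - A 1 0 * (A 0 0 * u + A 0 1) = 1 by lra.
  by rewrite den0 num0 !mulr0 subr0 => /esym/eqP; rewrite oner_eq0.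
split=> [[e]|e].
  have : A 0 0 * u + A 0 1 = u * (A 1 0 * u + A 1 1) by rewrite -[LHS](divfK den0) e.
  lra.
by congr Some; apply: (mulIf den0); rewrite divfK //; lra.
Qed.

Lemma bdry_fix_NoneP A :
  bdry_act (\pi_(PSL2 R) A) None = None <-> A 1 0 = 0.
Proof. by rewrite bdry_act_pi /=; case: eqP. Qed.

(** For two real ends, Vieta's formulas turn [c] times the half-circle equation into this one; an
    end at infinity means [c = 0], and the equation becomes linear. *)
Lemma axis_quadric A z : axis (\pi_(PSL2 R) A) z ->
  A 1 0 * (complex.Re z ^+ 2 + complex.Im z ^+ 2) +
  (A 1 1 - A 0 0) * complex.Re z - A 0 1 = 0.
Proof.
move=> [[u|] [[v|]]] // [uv].
- move=> /bdry_fix_SomeP Au /bdry_fix_SomeP Av /= gz.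
  have /eqP uv0 : u != v by apply: contraNneq uv => ->.
  have duv : u - v != 0 by rewrite subr_eq0; apply/eqP.
  have s : A 1 0 * (u + v) + (A 1 1 - A 0 0) = 0 by apply: (mulIf duv); lra.
  move: gz Au s; move: (complex.Re z) (complex.Im z) => x y gz Au s.
  have -> : A 1 0 * (x ^+ 2 + y ^+ 2) + (A 1 1 - A 0 0) * x - A 0 1 =
    A 1 0 * ((x - u) * (x - v) + y ^+ 2) + (x - u) * (A 1 0 * (u + v) + (A 1 1 - A 0 0)) +
    (A 1 0 * u ^+ 2 + (A 1 1 - A 0 0) * u - A 0 1) by ring.
  by rewrite gz Au s !mulr0 !addr0.
- by move=> /bdry_fix_SomeP Au /bdry_fix_NoneP c0 /= ->; move: Au; rewrite c0; lra.
- by move=> /bdry_fix_NoneP c0 /bdry_fix_SomeP Av /= ->; move: Av; rewrite c0; lra.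
- by rewrite eqxx in uv.
Qed.

(** Converse of [axis_quadric]: a solution with [Im z > 0] forces a positive discriminant, hence two
    distinct ideal fixed points. *)
Lemma quadric_hyperbolic_axis A z : \pi_(PSL2 R) A <> 1%g ->
  A 1 0 * (complex.Re z ^+ 2 + complex.Im z ^+ 2) +
  (A 1 1 - A 0 0) * complex.Re z - A 0 1 = 0 ->
  hyperbolic (\pi_(PSL2 R) A) /\ axis (\pi_(PSL2 R) A) z.
Proof.
move=> A1; case: z => -[x y] /= y0 qz; have dA := detSL2E A.
(* The discriminant of the fixed-point quadratic is the squared trace minus 4. *)
have trE : (A 0 0 + A 1 1) ^+ 2 = (A 1 1 - A 0 0) ^+ 2 + 4 * A 0 1 * A 1 0 + 4 by nra.
have hypE : 0 < (A 1 1 - A 0 0) ^+ 2 + 4 * A 0 1 * A 1 0 -> hyperbolic (\pi_(PSL2 R) A).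
  move=> disc; rewrite /hyperbolic abs_tr_pi mxtrace2.
  rewrite -(ltr_pXn2r (n := 2)) ?nnegrE // real_normK ?num_real // trE.
  by rewrite (_ : 2 ^+ 2 = 4 :> R); [rewrite ltrDr|ring].
(* Here infinity is fixed and the axis is the vertical line through [z]; equal diagonal entries
   would make [A] trivial. *)
have [c0|c0] := eqVneq (A 1 0) 0.
  have ad : A 1 1 - A 0 0 != 0.
    apply: contra_notN A1 => /eqP ad; apply/pi_eq1P; split=> //; last by lra.
    by move: qz; rewrite c0 ad; lra.
  split.
    by apply: hypE; rewrite c0 mulr0 addr0 exprn_even_gt0.
  exists (Some x), None; split => //; first apply/bdry_fix_SomeP; last exact/bdry_fix_NoneP.
  by move: qz; rewrite c0 !mul0r.
have disc : 0 < (A 1 1 - A 0 0) ^+ 2 + 4 * A 0 1 * A 1 0.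
  have -> : (A 1 1 - A 0 0) ^+ 2 + 4 * A 0 1 * A 1 0 =
    (2 * A 1 0 * x + (A 1 1 - A 0 0)) ^+ 2 + (2 * A 1 0 * y) ^+ 2 by nra.
  apply: ltr_wpDl; first exact: sqr_ge0.
  by rewrite exprn_even_gt0 //= !mulf_neq0 ?pnatr_eq0 // gt_eqF.
split; first exact: hypE.
set r := Num.sqrt ((A 1 1 - A 0 0) ^+ 2 + 4 * A 0 1 * A 1 0).
have r2 : r ^+ 2 = (A 1 1 - A 0 0) ^+ 2 + 4 * A 0 1 * A 1 0 by rewrite sqr_sqrtr // ltW.
have r0 : 0 < r by rewrite sqrtr_gt0.
(* A general [s] serves both roots, [s = r] and [s = - r]. *)
have root s : s ^+ 2 = r ^+ 2 ->
    A 1 0 * ((A 0 0 - A 1 1 + s) / (2 * A 1 0)) ^+ 2 +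
    (A 1 1 - A 0 0) * ((A 0 0 - A 1 1 + s) / (2 * A 1 0)) - A 0 1 = 0.
  move=> s2; have -> : A 1 0 * ((A 0 0 - A 1 1 + s) / (2 * A 1 0)) ^+ 2 +
    (A 1 1 - A 0 0) * ((A 0 0 - A 1 1 + s) / (2 * A 1 0)) - A 0 1 =
    (s ^+ 2 - ((A 1 1 - A 0 0) ^+ 2 + 4 * A 0 1 * A 1 0)) / (4 * A 1 0) by field.
  by rewrite s2 r2 subrr mul0r.
exists (Some ((A 0 0 - A 1 1 + r) / (2 * A 1 0))), (Some ((A 0 0 - A 1 1 + - r) / (2 * A 1 0))).
split; last 1 first.
- rewrite /geodesic /=.
  have -> : (x - (A 0 0 - A 1 1 + r) / (2 * A 1 0)) *
    (x - (A 0 0 - A 1 1 + - r) / (2 * A 1 0)) + y ^+ 2 =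
    (4 * A 1 0 * (A 1 0 * (x ^+ 2 + y ^+ 2) + (A 1 1 - A 0 0) * x - A 0 1) -
     (r ^+ 2 - ((A 1 1 - A 0 0) ^+ 2 + 4 * A 0 1 * A 1 0))) / (4 * A 1 0 ^+ 2) by field.
  by rewrite qz r2 subrr mulr0 subrr mul0r.
- apply/eqP=> -[] /(mulIf (invr_neq0 (mulf_neq0 _ c0))); rewrite pnatr_eq0 => /(_ isT); lra.
- exact/bdry_fix_SomeP/root.
- by apply/bdry_fix_SomeP/root; rewrite sqrrN.
Qed.

(** * Half-turns and reversal *)

(** With rows [(p, q)] and [(r, - p)], the fixed-point equation has discriminant
    [4 (p ^ 2 + q r) = - 4]. *)
Lemma trace0_fixed_point K : K 0 0 + K 1 1 = 0 ->
  exists z, act (\pi_(PSL2 R) K) z = z.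
Proof.
move=> t0; have dK := detSL2E K.
have s : K 1 1 = - K 0 0 by lra.
have r0 : K 1 0 != 0.
  apply/eqP=> r0; move: dK; rewrite r0 s; have := sqr_ge0 (K 0 0); lra.
(* The roots are [(p + i) / r] and [(p - i) / r]; the absolute value selects the one in the upper
   half-plane. *)
have y0 : 0 < complex.Im (Complex (K 0 0 / K 1 0) (`|K 1 0|^-1)).
  by rewrite /= invr_gt0 normr_gt0.
exists (MkUHP y0); apply/act_fixP => /=; rewrite s; split; first by field.
rewrite exprVn real_normK ?num_real //.
apply: (mulIf r0); rewrite s in dK.
have -> : - (K 1 0 * ((K 0 0 / K 1 0) ^+ 2 + K 1 0 ^- 2)) * K 1 0 = - (K 0 0 ^+ 2 + 1) by field.
lra.
Qed.

(* The half-turn [K] about [z] reverses [A] exactly when [tr (K A) = 0]; up to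
   the factor [K 1 0] this is the equation of the axis of [A] at [z]. *)
Lemma trace0_fix_quadric K A z : K 0 0 + K 1 1 = 0 -> act (\pi_(PSL2 R) K) z = z ->
  SL2_mul K A 0 0 + SL2_mul K A 1 1 = 0 <->
  A 1 0 * (complex.Re z ^+ 2 + complex.Im z ^+ 2) +
  (A 1 1 - A 0 0) * complex.Re z - A 0 1 = 0.
Proof.
move=> t0 /act_fixP[da b]; rewrite !SL2_mulE; have dK := detSL2E K.
move: da b; move: (complex.Re z) (complex.Im z) => x y da b.
have p : K 0 0 = K 1 0 * x by lra.
have s : K 1 1 = - (K 1 0 * x) by lra.
have r0 : K 1 0 != 0.
  apply/eqP=> r0; move: dK; rewrite p s b r0 !mul0r oppr0 !mulr0 subrr => /esym/eqP.
  by rewrite oner_eq0.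
rewrite p s b.
have -> : K 1 0 * x * A 0 0 + - (K 1 0 * (x ^+ 2 + y ^+ 2)) * A 1 0 +
    (K 1 0 * A 0 1 + - (K 1 0 * x) * A 1 1) =
  - K 1 0 * (A 1 0 * (x ^+ 2 + y ^+ 2) + (A 1 1 - A 0 0) * x - A 0 1) by ring.
split=> [/eqP|->]; last by rewrite mulr0.
by rewrite mulf_eq0 oppr_eq0 (negbTE r0) => /eqP.
Qed.

(** Both [k] and [k g] square to 1, so [k] is its own inverse and [k g k g = 1] rearranges to the
    claim. *)
Lemma trace0_reverses K A : K 0 0 + K 1 1 = 0 ->
  SL2_mul K A 0 0 + SL2_mul K A 1 1 = 0 ->
  (\pi_(PSL2 R) K * \pi_(PSL2 R) A * (\pi_(PSL2 R) K)^-1 = (\pi_(PSL2 R) A)^-1)%g.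
Proof.
move=> tK tKA.
have sqr1 B : B 0 0 + B 1 1 = 0 -> (\pi_(PSL2 R) B * \pi_(PSL2 R) B = 1)%g.
  by move=> tB; rewrite -expg2; apply/sqr_eq1_trace; right.
have := sqr1 _ tKA; rewrite -pi_mulE mulgA => e.
have -> : ((\pi_(PSL2 R) K)^-1 = \pi_(PSL2 R) K)%g.
  by apply/esym/eqP; rewrite -mulg_eq1; apply/eqP/sqr1.
by apply/eqP; rewrite -mulg_eq1; apply/eqP.
Qed.

Lemma reverses_trace0 K A : (\pi_(PSL2 R) A ^+ 2 <> 1)%g ->
  (\pi_(PSL2 R) K * \pi_(PSL2 R) A * (\pi_(PSL2 R) K)^-1 = (\pi_(PSL2 R) A)^-1)%g ->
  K 0 0 + K 1 1 = 0 /\ SL2_mul K A 0 0 + SL2_mul K A 1 1 = 0.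
Proof.
move=> A2 KA; have dK := detSL2E K.
have {}KA : \pi_(PSL2 R) (SL2_mul K A) = \pi_(PSL2 R) (SL2_mul (SL2_inv A) K).
  by rewrite -!pi_mulE -pi_invE -KA mulgVK.
have [A1 /eqP tA] : \pi_(PSL2 R) A <> 1%g /\ A 0 0 + A 1 1 != 0.
  by split=> [A1|]; [apply: A2; rewrite A1 expg1n|apply: contra_notN A2 => /eqP tA;
     apply/sqr_eq1_trace; right].
move: KA => /pi_eqP; rewrite !SL2_mulE SL2_invE !mx2E => -[][e1 e2 e3 e4]; last first.
  (* Sign minus: multiplying both sides by the inverse of [K] and taking traces gives
     [tr A = - tr A]. *)
  exfalso; apply: tA.
  have : (A 0 0 + A 1 1) * (K 0 0 * K 1 1 - K 0 1 * K 1 0) =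
      - ((A 0 0 + A 1 1) * (K 0 0 * K 1 1 - K 0 1 * K 1 0)).
    transitivity (K 1 1 * (K 0 0 * A 0 0 + K 0 1 * A 1 0) -
      K 0 1 * (K 1 0 * A 0 0 + K 1 1 * A 1 0) -
      K 1 0 * (K 0 0 * A 0 1 + K 0 1 * A 1 1) +
      K 0 0 * (K 1 0 * A 0 1 + K 1 1 * A 1 1)); first by ring.
    by rewrite e1 e2 e3 e4; ring.
  by rewrite dK; lra.
(* Sign plus: once [tr K = 0], the top left entry of the equation reads [tr (K A) = 0]. *)
have [tK|tK] := eqVneq (K 0 0 + K 1 1) 0.
  have s : K 1 1 = - K 0 0 by lra.
  by split=> //; move: e1; rewrite s; lra.
(* The equation makes [tr K] times [b], [c] and [a - d] vanish, so a nonzero [tr K] would make [A]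
   scalar. *)
exfalso; apply: A1; apply/pi_eq1P; split.
- by apply: (mulIf tK); lra.
- by apply: (mulIf tK); lra.
- by apply: (mulIf tK); lra.
Qed.

(** * Rotations about a point *)

(* The elliptic element fixing [z] written as [cos t + sin t * J], where [J] is
   the half-turn about [z] and [J ^ 2 = -1]. *)
Lemma det_rot_mx z (t : R) : \det (mx2
  (cos t + sin t * (complex.Re z / complex.Im z))
  (- (sin t * ((complex.Re z ^+ 2 + complex.Im z ^+ 2) / complex.Im z)))
  (sin t / complex.Im z)
  (cos t - sin t * (complex.Re z / complex.Im z))) == 1.
Proof.
apply/eqP; rewrite det_mx2 !mx2E; case: z => -[x y] /= y0.
rewrite -(cos2Dsin2 t); field; exact: lt0r_neq0.
Qed.

Definition rot z t : SL2 R := MkSL2 (det_rot_mx z t).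

Lemma pi_rotD z (s t : R) :
  \pi_(PSL2 R) (rot z (s + t)) = (\pi_(PSL2 R) (rot z s) * \pi_(PSL2 R) (rot z t))%g.
Proof.
rewrite pi_mulE; apply/pi_eqP; left.
rewrite !SL2_mulE !mx2E; case: z => -[x y] /= y0.
have yn0 := lt0r_neq0 y0.
by rewrite cosD sinD; split; field.
Qed.

Lemma pi_rot0 z : \pi_(PSL2 R) (rot z 0) = 1%g.
Proof. by apply/pi_eq1P; rewrite !mx2E sin0 cos0 !mul0r oppr0 !addr0. Qed.

(** The matrix is [- 1]: the parameter is half the rotation angle, so a full turn is reached at
    [pi]. *)
Lemma pi_rotpi z : \pi_(PSL2 R) (rot z pi) = 1%g.
Proof. by apply/pi_eq1P; rewrite !mx2E sinpi !mul0r oppr0 !addr0. Qed.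

Lemma pi_rotMn z (t : R) k : \pi_(PSL2 R) (rot z (k%:R * t)) = (\pi_(PSL2 R) (rot z t) ^+ k)%g.
Proof.
elim: k => [|k IH]; first by rewrite mul0r pi_rot0.
by rewrite -natr1 mulrDl mul1r pi_rotD IH expgSr.
Qed.

Lemma pi_rotB z (s t : R) :
  \pi_(PSL2 R) (rot z (s - t)) = (\pi_(PSL2 R) (rot z s) / \pi_(PSL2 R) (rot z t))%g.
Proof. by apply: (mulIg (\pi_(PSL2 R) (rot z t))); rewrite -pi_rotD mulgVK subrK. Qed.

Lemma pi_rot_neq1 z (t : R) : 0 < t < pi -> \pi_(PSL2 R) (rot z t) <> 1%g.
Proof.
move=> tpi /pi_eq1P[_ + _]; rewrite mx2E; case: z => -[x y] /= y0 /eqP.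
by rewrite mulf_eq0 invr_eq0 (gt_eqF y0) (gt_eqF (sin_gt0_pi tpi)).
Qed.

Lemma act_rot z (t : R) : act (\pi_(PSL2 R) (rot z t)) z = z.
Proof.
apply/act_fixP; rewrite !mx2E; case: z => -[x y] /= y0.
by split; field; exact: lt0r_neq0.
Qed.

(** Half the trace and [c Im z] have squares summing to 1, so they are [cos t] and [sin t]. *)
Lemma fix_rot z (g : PSL2 R) : act g z = z ->
  exists2 t, 0 <= t & g = \pi_(PSL2 R) (rot z t).
Proof.
(* The sign of the lift is chosen so that [sin t >= 0], as [acos] requires. *)
elim/PSL2W: g => A; wlog sgn : A / 0 <= A 1 0 => [hw|].
  have [|/ltW c0] := lerP 0 (A 1 0); first exact: hw.
  have dN : \det (- (A : 'M[R]_2)) == 1.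
    by rewrite -scaleN1r detZ sqrrN expr1n mul1r SL2_det.
  have -> : \pi_(PSL2 R) A = \pi_(PSL2 R) (MkSL2 dN).
    by apply/pi_eqP; right; rewrite !mxE !opprK.
  by apply: hw; rewrite mxE oppr_ge0.
move=> /act_fixP[]; have dA := detSL2E A.
case: z => -[x y] /= y0 da b; have yn0 := lt0r_neq0 y0.
have dE : ((A 0 0 + A 1 1) / 2) ^+ 2 + (A 1 0 * y) ^+ 2 = 1.
  rewrite -[RHS]dA b (_ : A 1 1 = A 0 0 - 2 * A 1 0 * x); first by field.
  lra.
have bnd : -1 <= (A 0 0 + A 1 1) / 2 <= 1.
  have := sqr_ge0 (A 1 0 * y); rewrite -ler_norml => s0.
  by rewrite -(@ler_pXn2r _ 2) ?nnegrE // expr1n real_normK ?num_real //; lra.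
exists (acos ((A 0 0 + A 1 1) / 2)); first exact: acos_ge0.
have sE : sin (acos ((A 0 0 + A 1 1) / 2)) = A 1 0 * y.
  rewrite sin_acos // -[X in X - _]dE addrAC subrr add0r sqrtr_sqr ger0_norm //.
  by rewrite mulr_ge0 // ltW.
apply/pi_eqP; left; rewrite !mx2E /= sE acosK //; split.
- have -> : A 1 0 * y * (x / y) = A 1 0 * x by field.
  by lra.
- by rewrite b; field.
- by field.
- have -> : A 1 0 * y * (x / y) = A 1 0 * x by field.
  by lra.
Qed.

Lemma continuous_rot z : continuous (fun t : R => \pi_(PSL2 R) (rot z t) : PSL2 R).
Proof.
move=> t; apply: (@continuous_comp _ _ _ (rot z) (\pi_(PSL2 R))); last exact: pi_continuous.
move: t; apply: (@continuous_comp_initial _ _ _ (@SL2_mx R) (rot z)) => t.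
have cM (k : R) : (fun s : R => sin s * k) @ t --> sin t * k.
  by apply: cvgMl; exact: continuous_sin.
have ext i j (h : R -> R) : (forall s, rot z s i j = h s) -> h @ t --> h t ->
    (fun s => rot z s i j : R) @ t --> (rot z t i j : R).
  by move=> rh; rewrite rh (_ : (fun s => rot z s i j : R) = h) //; apply/funext.
have cont i j : (fun s => rot z s i j : R) @ t --> (rot z t i j : R).
  move: i j; apply: ord2_forall; apply: ord2_forall.
  - apply: (ext _ _ (fun s => cos s + sin s * (complex.Re z / complex.Im z))).
      by move=> s; rewrite mx2E.
    by apply: cvgD; [exact: continuous_cos|exact: cM].
  - apply: (ext _ _ (fun s => - (sin s * ((complex.Re z ^+ 2 + complex.Im z ^+ 2) / complex.Im z)))).
      by move=> s; rewrite mx2E.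
    by apply: cvgN; exact: cM.
  - by apply: (ext _ _ (fun s => sin s / complex.Im z)); [move=> s; rewrite mx2E|exact: cM].
  - apply: (ext _ _ (fun s => cos s - sin s * (complex.Re z / complex.Im z))).
      by move=> s; rewrite mx2E.
    by apply: cvgB; [exact: continuous_cos|exact: cM].
(* A matrix neighbourhood contains a product of entrywise ones, and only finitely many entries have
   to be controlled. *)
move=> B [P P_nbhs PB].
suff : \forall s \near t, forall i j, P i j (rot z s i j).
  by apply: filterS => s Ps; exact: PB.
have near_ij i j : \forall s \near t, P i j (rot z s i j) by exact/cont/P_nbhs.
have near_i i : \forall s \near t, forall j, P i j (rot z s i j).
  exact: (filter_forall (nbhs_filter t) (near_ij i)).
exact: (filter_forall (nbhs_filter t) near_i).
Qed.

End MatrixEntries.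

(** * Point stabilizers in a Fuchsian group *)

Section Fuchsian.
Variables (R : realType) (G : set (PSL2 R)).

(** A neighbourhood isolating 1 in [G] pulls back to a ball about angle 0; capping it at [pi] keeps
    the rotations nontrivial. *)
Lemma rot_discrete (z : UHP R) : fuchsian G -> exists2 e : R, 0 < e &
  forall t, 0 < t < e -> ~ G (\pi_(PSL2 R) (rot z t)).
Proof.
move=> [[G1 _] /(_ 1%g)]; rewrite inE in G1.
move=> /(_ G1)[_ [V V1 VG]].
have : nbhs (0 : R) ((fun t => \pi_(PSL2 R) (rot z t) : PSL2 R) @^-1` V).
  by apply: continuous_rot; rewrite pi_rot0.
move=> /nbhs_ballP[d d0 dV]; exists (Num.min d pi); first by rewrite lt_min d0 pi_gt0.
move=> t; rewrite lt_min => /and3P[t0 td tpi] Gt.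
apply: (@pi_rot_neq1 _ z t); first by rewrite t0.
have : (V `&` G) (\pi_(PSL2 R) (rot z t)).
  by split=> //; apply: dV; rewrite /ball /= sub0r normrN gtr0_norm.
by rewrite VG.
Qed.

Lemma fuchsian_stabilizer_cyclic (z : UHP R) : fuchsian G ->
  exists n a,
  [/\ (a ^+ n = 1)%g, stabilizer G z = [set (a ^+ k)%g | k in [set: nat]] &
      finite_cyclic_of_order n (stabilizer G z)].
Proof.
move=> G_fuchsian; have [e e0 Ge] := rot_discrete z G_fuchsian.
have [[G1 GB] _] := G_fuchsian.
have GX g k : g \in G -> (g ^+ k \in G)%g.
  by move=> gG; elim: k => [//|k IH]; rewrite expgS (group_closedM (conj G1 GB)).
have [t [t0 Gt tP]] := @discrete_subgroup_line R
  (fun t => \pi_(PSL2 R) (rot z t) \in G) e pi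
  (fun s t Gs Gt => eq_ind_r (fun g => g \in G) (GB _ _ Gs Gt) (pi_rotB z s t)) e0
  (fun s se Gs => Ge s se (set_mem Gs)) (pi_gt0 R)
  (eq_ind_r (fun g => g \in G) G1 (pi_rotpi z)).
(* Since [pi] is an admissible angle, it is a multiple [n * t] of the generator, and [n] is the
   order of the stabilizer. *)
have [n npi] := tP _ (pi_ge0 R) (eq_ind_r (fun g => g \in G) G1 (pi_rotpi z)).
have n0 : (0 < n)%N.
  by case: n npi => // /eqP; rewrite mul0r gt_eqF ?pi_gt0.
have HE : stabilizer G z = [set (\pi_(PSL2 R) (rot z t) ^+ k)%g | k in [set: nat]].
  apply/seteqP; split=> [g [gG /fix_rot[s s0 gE]]|_ [k _ <-]].
    have [k sk] := tP _ s0 (eq_ind g (fun g => g \in G) gG _ gE).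
    by exists k => //; rewrite -pi_rotMn -sk.
  by split; [exact: GX|rewrite -pi_rotMn act_rot].
have an : (\pi_(PSL2 R) (rot z t) ^+ n = 1)%g by rewrite -pi_rotMn -npi pi_rotpi.
exists n, (\pi_(PSL2 R) (rot z t)); split=> //; split; last by exists (\pi_(PSL2 R) (rot z t)).
rewrite HE; apply: card_powers_order => //.
move=> j /andP[j0 jn]; rewrite -pi_rotMn; apply/eqP/pi_rot_neq1.
by rewrite npi mulr_gt0 ?ltr0n // ltr_pM2r // ltr_nat.
Qed.

(** If [n] were odd, [k ^ 2 = 1] and [k ^ n = 1] would give [k = 1]. *)
Lemma involution_even_stabilizer (z : UHP R) (k : PSL2 R) :
  fuchsian G -> k \in G -> act k z = z -> involution k ->
  exists2 n, ~~ odd n & finite_cyclic_of_order n (stabilizer G z).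
Proof.
move=> G_fuchsian kG kz [k1 k2].
have [n [a [an HE cyc]]] := fuchsian_stabilizer_cyclic z G_fuchsian; exists n => //.
apply/negP=> n_odd; apply: k1.
have : stabilizer G z k by [].
rewrite HE => -[j _ ka].
transitivity (k ^+ n)%g; last by rewrite -ka expgnAC an expg1n.
by rewrite -(odd_double_half n) n_odd expgS -mul2n expgnA k2 expg1n mulg1.
Qed.

Lemma even_vertex_involution (D : set (UHP R)) (p : UHP R) :
  even_order_vertex G D p -> exists k, [/\ k \in G, act k p = p & involution k].
Proof.
move=> [_ [n n_even [card_n [a HE]]]].
have [j [aj1 aj2]] : exists j, (a ^+ j != 1)%g /\ (a ^+ j ^+ 2 = 1)%g.
  by apply: (even_cyclic_involution n_even); rewrite -HE.
have [kG kp] : stabilizer G p (a ^+ j)%g by rewrite HE; exists j.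
by exists (a ^+ j)%g; split=> //; split=> //; apply/eqP.
Qed.

(** * Reversing elements and the equivalence *)

Lemma reversing_halfturn (g k : PSL2 R) :
  (g ^+ 2 <> 1)%g -> (k * g * k^-1 = g^-1)%g ->
  [/\ involution k, elliptic k, exists z, act k z = z &
      forall z, act k z = z -> hyperbolic g /\ axis g z].
Proof.
elim/PSL2W: g => A; elim/PSL2W: k => K A2 KA.
have [tK tKA] := reverses_trace0 A2 KA.
have A1 : \pi_(PSL2 R) A <> 1%g by move=> A1; apply: A2; rewrite A1 expg1n.
split.
- split; last by apply/sqr_eq1_trace; right.
  move=> K1; apply: A2; move: KA; rewrite K1 mul1g invg1 mulg1 => AV.
  by rewrite expg2 {2}AV mulgV.
- by rewrite /elliptic abs_tr_pi mxtrace2 tK normr0 ltr0n.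
- exact: trace0_fixed_point.
- move=> z Kz; apply: quadric_hyperbolic_axis => //.
  exact/(trace0_fix_quadric A tK Kz).
Qed.

Lemma hyperbolic1N : ~ hyperbolic (1%g : PSL2 R).
Proof.
rewrite (_ : 1%g = \pi_(PSL2 R) (SL2_one R)) // /hyperbolic abs_tr_pi mxtrace2.
by rewrite /= !mxE /= ger0_norm ?ltxx // addr_ge0 // ler0n.
Qed.

Lemma reciprocal_conj (g m : PSL2 R) : fuchsian G -> m \in G ->
  reciprocal G (m * g * m^-1)%g -> reciprocal G g.
Proof.
move=> [GC _] mG [g1 [k kG kg]]; have GM := group_closedM GC; have GV := group_closedV GC.
split; first by move=> ge; apply: g1; rewrite ge mulg1 mulgV.
exists (m^-1 * k * m)%g; first by rewrite !GM ?GV.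
apply: (mulgI m); apply: (mulIg m^-1%g).
by move: kg; rewrite !invgM !invgK !mulgA mulgV mul1g mulgK.
Qed.

End Fuchsian.

Theorem theorem2p1 (R : realType) (G : set (PSL2 R)) (D : set (UHP R))
    (G_fuchsian : fuchsian G) (G_fg : finitely_generated G)
    (D_fund : fundamental_polygon G D) (g : PSL2 R) (gG : g \in G) :
  reciprocal G g <->
  (involution g \/
   exists h, [/\ conjugate_in G g h, hyperbolic h &
     exists2 p, even_order_vertex G D p & axis h p]).
Proof.
have [GC _] := G_fuchsian; have [G1 _] := GC.
have GM := group_closedM GC; have GV := group_closedV GC.
split; last first.
  move=> [[g1 g2]|[h [[m mG hE] h_hyp [p /even_vertex_involution[k [kG kp [k1 k2]]] hp]]]].
    split=> //; exists 1%g => //; rewrite mul1g invg1 mulg1.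
    by apply/eqP; rewrite -mulg_eq1 -expg2; apply/eqP.
  (* It suffices to reverse [h]; the involution in the stabilizer of [p] is a half-turn about a
     point of the axis. *)
  apply: (reciprocal_conj G_fuchsian mG); rewrite -hE; split; last first.
    exists k => //; move: hp kp k1 k2 {kG hE h_hyp}; elim/PSL2W: h => A; elim/PSL2W: k => K.
    move=> /axis_quadric qA Kp K1 /sqr_eq1_trace[//|tK].
    by apply: trace0_reverses => //; apply/(trace0_fix_quadric A tK Kp).
  by move=> h1; move: h_hyp; rewrite h1; exact: hyperbolic1N.
move=> [g1 [k kG kg]].
have [g2|g2] := pselect (g ^+ 2 = 1)%g; [by left|right].
have [_ _ [z kz] _] := reversing_halfturn g2 kg.
have [_ cover _] := D_fund.
have : [set: UHP R] z by [].
(* Some [m] in [G] carries a point [p] of [D] to the centre [z]; conjugating by its inverse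
   recentres the half-turn at [p]. *)
rewrite -cover => -[m mG [p Dp mp]]; have {}mG : m \in G by rewrite inE.
pose h := (m^-1 * g * m)%g; pose k' := (m^-1 * k * m)%g.
have h2 : (h ^+ 2 <> 1)%g.
  move=> h2; apply: g2; apply: (mulgI m^-1%g); apply: (mulIg m).
  by move: h2; rewrite mulg1 mulVg !expg2 /h !mulgA mulgK.
have kh : (k' * h * k'^-1 = h^-1)%g.
  rewrite /h /k' !invgM !invgK !mulgA !mulgK.
  by rewrite -!mulgA; congr (_ * _)%g; rewrite !mulgA kg.
have k'p : act k' p = p by rewrite !actM mp kz -mp -actM mulVg act1.
have k'G : k' \in G by rewrite !GM ?GV.
have [k'inv k'ell _ /(_ p k'p)[h_hyp hp]] := reversing_halfturn h2 kh.
exists h; split => //; first by exists m^-1%g; rewrite ?GV // invgK.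
exists p => //; split; last exact: involution_even_stabilizer k'inv.
(* [p] is a vertex as an elliptic fixed point in [D], whether or not it is a corner. *)
by right; split=> //; exists k'.
Qed.
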